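(* Let $\mathbf S$ be a Frobenius separable monad on a Cauchy complete category $\mathbb A$. Then for any morphism $\iota:\mathbf S\to\mathbf T$ of monads on $\mathbb A$, the change-of-base functor $\iota_!:\mathbb A_{\mathbf S}\to\mathbb A_{\mathbf T}$ exists.
   Context: A category is Cauchy complete if every idempotent splits. For a monad $\mathbf T$ on $\mathbb A$, $\mathbb A_{\mathbf T}$ is its Eilenberg–Moore category. A monad $\mathbf S=(S,m^S,e^S)$ on $\mathbb A$ is Frobenius if $S$ carries a comonad structure $(S,\delta^S,\varepsilon^S)$ with $Sm^S\cdot\delta^SS=\delta^S\cdot m^S=m^SS\cdot S\delta^S$; it is Frobenius separable if moreover $m^S\cdot\delta^S=1$. A morphism of monads $\iota:\mathbf S=(S,m^S,e^S)\to\mathbf T=(T,m^T,e^T)$ is a natural transformation $\iota:S\to T$ with $\iota\cdot e^S=e^T$ and $\iota\cdot m^S=m^T\cdot(\iota\iota)$. It induces the restriction-of-base functor $\iota^*:\mathbb A_{\mathbf T}\to\mathbb A_{\mathbf S}$, $(a,h)\mapsto(a,h\cdot\iota_a)$; the change-of-base functor $\iota_!:\mathbb A_{\mathbf S}\to\mathbb A_{\mathbf T}$ is, when it exists, the left adjoint of $\iota^*$. *)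

(* Defs.v *)
From Stdlib Require Import ProofIrrelevance.

Set Implicit Arguments.
Unset Strict Implicit.
Unset Printing Implicit Defensive.

Declare Scope cat_scope.
Delimit Scope cat_scope with cat.
Local Open Scope cat_scope.

(** Morphisms are compared with Leibniz equality. *)
Record category := Category {
  ob :> Type;
  hom : ob -> ob -> Type;
  idm : forall a, hom a a;
  comp : forall a b c, hom b c -> hom a b -> hom a c;
  comp_idl : forall a b (f : hom a b), comp (idm b) f = f;
  comp_idr : forall a b (f : hom a b), comp f (idm a) = f;
  comp_assoc : forall a b c d (h : hom c d) (g : hom b c) (f : hom a b),
    comp h (comp g f) = comp (comp h g) f }.

Arguments hom {_} _ _.
Arguments idm {_} _.
Arguments comp {_ _ _ _} _ _.

(** [g ∘ f] is "first [f], then [g]". *)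
Notation "g ∘ f" := (comp g f) (at level 40, left associativity) : cat_scope.

Definition splits (A : category) (a : A) (e : hom a a) : Prop :=
  exists (b : A) (r : hom a b) (s : hom b a), s ∘ r = e /\ r ∘ s = idm b.

Definition cauchy_complete (A : category) : Prop :=
  forall (a : A) (e : hom a a), e ∘ e = e -> splits e.

Record functor (A B : category) := Functor {
  fob :> A -> B;
  fmap : forall a b, hom a b -> hom (fob a) (fob b);
  fmap_id : forall a, fmap (idm a) = idm (fob a);
  fmap_comp : forall a b c (g : hom b c) (f : hom a b),
    fmap (g ∘ f) = fmap g ∘ fmap f }.

Arguments fmap {_ _} _ {_ _} _.

Definition functor_id (A : category) : functor A A :=
  {| fob := fun a => a;
     fmap := fun _ _ f => f;
     fmap_id := fun _ => eq_refl;
     fmap_comp := fun _ _ _ _ _ => eq_refl |}.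

Section FunctorComp.
Variables (A B C : category) (G : functor B C) (F : functor A B).

Lemma functor_comp_id (a : A) : fmap G (fmap F (idm a)) = idm (G (F a)).
Proof. rewrite fmap_id; apply fmap_id. Qed.

Lemma functor_comp_comp (a b c : A) (g : hom b c) (f : hom a b) :
  fmap G (fmap F (g ∘ f)) = fmap G (fmap F g) ∘ fmap G (fmap F f).
Proof. rewrite fmap_comp; apply fmap_comp. Qed.

Definition functor_comp : functor A C :=
  {| fob := fun a => G (F a);
     fmap := fun _ _ f => fmap G (fmap F f);
     fmap_id := functor_comp_id;
     fmap_comp := functor_comp_comp |}.
End FunctorComp.

Record nat_trans (A B : category) (F G : functor A B) := NatTrans {
  component :> forall a, hom (F a) (G a);
  naturality : forall a b (f : hom a b),
    component b ∘ fmap F f = fmap G f ∘ component a }.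

Section HorizontalComp.
Variables (A B C : category) (F F' : functor A B) (G G' : functor B C).
Variables (beta : nat_trans G G') (alpha : nat_trans F F').

Lemma hcomp_naturality (a b : A) (f : hom a b) :
  (beta (F' b) ∘ fmap G (alpha b)) ∘ fmap (functor_comp G F) f
  = fmap (functor_comp G' F') f ∘ (beta (F' a) ∘ fmap G (alpha a)).
Proof.
simpl. rewrite <- comp_assoc, <- fmap_comp, (naturality alpha), fmap_comp.
now rewrite comp_assoc, (naturality beta), comp_assoc.
Qed.

(** Godement product: [beta alpha : GF -> G'F']. *)
Definition hcomp : nat_trans (functor_comp G F) (functor_comp G' F') :=
  @NatTrans _ _ (functor_comp G F) (functor_comp G' F')
    (fun a => beta (F' a) ∘ fmap G (alpha a)) hcomp_naturality.
End HorizontalComp.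

Record adjunction (A B : category) (L : functor A B) (R : functor B A) :=
  Adjunction {
    adj_unit : nat_trans (functor_id A) (functor_comp R L);
    adj_counit : nat_trans (functor_comp L R) (functor_id B);
    adj_triangle_l : forall a,
      adj_counit (L a) ∘ fmap L (adj_unit a) = idm (L a);
    adj_triangle_r : forall b,
      fmap R (adj_counit b) ∘ adj_unit (R b) = idm (R b) }.

Definition has_left_adjoint (A B : category) (R : functor B A) : Prop :=
  exists L : functor A B, inhabited (adjunction L R).

Record monad (A : category) := Monad {
  mfun :> functor A A;
  mult : nat_trans (functor_comp mfun mfun) mfun;
  unit : nat_trans (functor_id A) mfun;
  mult_assoc : forall a, mult a ∘ fmap mfun (mult a) = mult a ∘ mult (mfun a);
  mult_unitl : forall a, mult a ∘ unit (mfun a) = idm (mfun a);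
  mult_unitr : forall a, mult a ∘ fmap mfun (unit a) = idm (mfun a) }.

Arguments mult {_} _.
Arguments unit {_} _.

Record comonad_structure (A : category) (S : functor A A) := ComonadStructure {
  comult : nat_trans S (functor_comp S S);
  counit : nat_trans S (functor_id A);
  comult_coassoc : forall a, fmap S (comult a) ∘ comult a = comult (S a) ∘ comult a;
  comult_counitl : forall a, counit (S a) ∘ comult a = idm (S a);
  comult_counitr : forall a, fmap S (counit a) ∘ comult a = idm (S a) }.

(** [S m . delta S = delta . m = m S . S delta] *)
Definition frobenius_law (A : category) (S : monad A)
    (D : comonad_structure S) : Prop :=
  forall a : A,
    fmap S (mult S a) ∘ comult D (S a) = comult D a ∘ mult S a
    /\ comult D a ∘ mult S a = mult S (S a) ∘ fmap S (comult D a).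

Definition frobenius (A : category) (S : monad A) : Prop :=
  exists D : comonad_structure S, frobenius_law D.

Definition frobenius_separable (A : category) (S : monad A) : Prop :=
  exists D : comonad_structure S,
    frobenius_law D /\ forall a : A, mult S a ∘ comult D a = idm (S a).

Section EilenbergMoore.
Variables (A : category) (T : monad A).

Record algebra := Algebra {
  carrier : A;
  action : hom (T carrier) carrier;
  action_unit : action ∘ unit T carrier = idm carrier;
  action_mult : action ∘ mult T carrier = action ∘ fmap T action }.

Record algebra_hom (x y : algebra) := AlgebraHom {
  under : hom (carrier x) (carrier y);
  under_action : under ∘ action x = action y ∘ fmap T under }.

Lemma algebra_hom_eq (x y : algebra) (f g : algebra_hom x y) :
  under f = under g -> f = g.
Proof.
destruct f as [f Hf], g as [g Hg]; simpl; intros <-.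
now rewrite (proof_irrelevance _ Hf Hg).
Qed.

Lemma algebra_id_action (x : algebra) :
  idm (carrier x) ∘ action x = action x ∘ fmap T (idm (carrier x)).
Proof. now rewrite fmap_id, comp_idl, comp_idr. Qed.

Definition algebra_id (x : algebra) : algebra_hom x x :=
  {| under := idm (carrier x); under_action := algebra_id_action x |}.

Lemma algebra_comp_action (x y z : algebra)
    (g : algebra_hom y z) (f : algebra_hom x y) :
  (under g ∘ under f) ∘ action x = action z ∘ fmap T (under g ∘ under f).
Proof.
rewrite <- comp_assoc, under_action, comp_assoc, under_action.
now rewrite fmap_comp, comp_assoc.
Qed.

Definition algebra_comp (x y z : algebra)
    (g : algebra_hom y z) (f : algebra_hom x y) : algebra_hom x z :=
  {| under := under g ∘ under f; under_action := algebra_comp_action g f |}.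

Lemma algebra_comp_idl (x y : algebra) (f : algebra_hom x y) :
  algebra_comp (algebra_id y) f = f.
Proof. apply algebra_hom_eq, comp_idl. Qed.

Lemma algebra_comp_idr (x y : algebra) (f : algebra_hom x y) :
  algebra_comp f (algebra_id x) = f.
Proof. apply algebra_hom_eq, comp_idr. Qed.

Lemma algebra_comp_assoc (x y z w : algebra) (h : algebra_hom z w)
    (g : algebra_hom y z) (f : algebra_hom x y) :
  algebra_comp h (algebra_comp g f) = algebra_comp (algebra_comp h g) f.
Proof. apply algebra_hom_eq, comp_assoc. Qed.

Definition eilenberg_moore : category :=
  {| ob := algebra;
     hom := algebra_hom;
     idm := algebra_id;
     comp := algebra_comp;
     comp_idl := algebra_comp_idl;
     comp_idr := algebra_comp_idr;
     comp_assoc := algebra_comp_assoc |}.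
End EilenbergMoore.

Record monad_morphism (A : category) (S T : monad A) := MonadMorphism {
  mm_trans :> nat_trans S T;
  mm_unit : forall a, mm_trans a ∘ unit S a = unit T a;
  mm_mult : forall a,
    mm_trans a ∘ mult S a = mult T a ∘ hcomp mm_trans mm_trans a }.

Section Restriction.
Variables (A : category) (S T : monad A) (iota : monad_morphism S T).

Lemma restrict_unit (x : algebra T) :
  (action x ∘ iota (carrier x)) ∘ unit S (carrier x) = idm (carrier x).
Proof. rewrite <- comp_assoc, mm_unit; apply action_unit. Qed.

Lemma restrict_mult (x : algebra T) :
  (action x ∘ iota (carrier x)) ∘ mult S (carrier x)
  = (action x ∘ iota (carrier x)) ∘ fmap S (action x ∘ iota (carrier x)).
Proof.
rewrite <- comp_assoc, mm_mult, comp_assoc, action_mult; simpl.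
rewrite fmap_comp, !comp_assoc; f_equal.
now rewrite <- !comp_assoc, naturality.
Qed.

Definition restrict_algebra (x : algebra T) : algebra S :=
  {| carrier := carrier x;
     action := action x ∘ iota (carrier x);
     action_unit := restrict_unit x;
     action_mult := restrict_mult x |}.

Lemma restrict_hom_action (x y : algebra T) (f : algebra_hom x y) :
  under f ∘ action (restrict_algebra x)
  = action (restrict_algebra y) ∘ fmap S (under f).
Proof.
simpl. now rewrite comp_assoc, under_action, <- !comp_assoc, naturality.
Qed.

Definition restrict_hom (x y : algebra T) (f : algebra_hom x y) :
    algebra_hom (restrict_algebra x) (restrict_algebra y) :=
  {| under := under f : hom (carrier (restrict_algebra x))
                            (carrier (restrict_algebra y));
     under_action := restrict_hom_action f |}.

Lemma restrict_id (x : algebra T) :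
  restrict_hom (algebra_id x) = algebra_id (restrict_algebra x).
Proof. now apply algebra_hom_eq. Qed.

Lemma restrict_comp (x y z : algebra T)
    (g : algebra_hom y z) (f : algebra_hom x y) :
  restrict_hom (algebra_comp g f)
  = algebra_comp (restrict_hom g) (restrict_hom f).
Proof. now apply algebra_hom_eq. Qed.

(** [iota^* : A_T -> A_S]; the change-of-base functor [iota_!] is its left
    adjoint. *)
Definition restriction_of_base :
    functor (eilenberg_moore T) (eilenberg_moore S) :=
  @Functor (eilenberg_moore T) (eilenberg_moore S)
    restrict_algebra restrict_hom restrict_id restrict_comp.

Definition change_of_base_exists : Prop :=
  has_left_adjoint restriction_of_base.
End Restriction.

(* Main.v *)
Require Import Defs.
From Stdlib Require Import ClassicalEpsilon.

(** For an [S]-algebra [(a, h)], the map [S h . delta . e : a -> S a] is an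
    algebra section of [h : (S a, m) -> (a, h)], so every [S]-algebra is a
    retract of a free one.  On free algebras [iota_!] is given by
    [(S a, m) |-> (T a, m)], and since idempotents split in [A], hence in
    [A_T], the partial left adjoint extends to retracts. *)

Set Implicit Arguments.
Unset Strict Implicit.
Unset Printing Implicit Defensive.

Local Open Scope cat_scope.

(* Syntactic matching fails on object arguments such as [functor_id A a], which
   are convertible but not identical to [a]. *)
Ltac rewrite_simpl H :=
  let E := fresh in pose proof H as E; simpl in E |- *; rewrite E; clear E.

(** * Left adjoints assembled from universal arrows *)

Definition universal_arrow (A B : category) (R : functor B A) (x : A) (l : B)
    (eta : hom x (R l)) : Prop :=
  forall (y : B) (f : hom x (R y)), exists! g : hom l y, fmap R g ∘ eta = f.

Lemma universal_arrow_ext (A B : category) (R : functor B A) (x : A) (l : B)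
    (eta : hom x (R l)) (y : B) (g g' : hom l y) :
  universal_arrow eta -> fmap R g ∘ eta = fmap R g' ∘ eta -> g = g'.
Proof.
intros U E. destruct (U y (fmap R g' ∘ eta)) as [k [_ Hk]].
rewrite <- (Hk g E). now apply Hk.
Qed.

Section LeftAdjoint.
Variables (A B : category) (R : functor B A) (l : A -> B).
Variable eta : forall x, hom x (R (l x)).
Hypothesis eta_universal : forall x, universal_arrow (eta x).

(** [exists!] lives in [Prop], so the factorization is extracted by indefinite description; its
    uniqueness is later used through [universal_arrow_ext]. *)
Definition transpose (x : A) (y : B) (f : hom x (R y)) : hom (l x) y :=
  proj1_sig (constructive_indefinite_description _ (eta_universal f)).

Lemma transpose_eta (x : A) (y : B) (f : hom x (R y)) :
  fmap R (transpose f) ∘ eta x = f.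
Proof.
unfold transpose.
now destruct constructive_indefinite_description as [g [Hg ?]].
Qed.

Lemma left_adjoint_id (x : A) :
  transpose (eta x ∘ idm x) = idm (l x).
Proof.
apply (universal_arrow_ext (eta_universal (x := x))).
now rewrite transpose_eta, fmap_id, comp_idl, comp_idr.
Qed.

Lemma left_adjoint_comp (x y z : A) (g : hom y z) (f : hom x y) :
  transpose (eta z ∘ (g ∘ f))
  = transpose (eta z ∘ g) ∘ transpose (eta y ∘ f).
Proof.
apply (universal_arrow_ext (eta_universal (x := x))).
rewrite fmap_comp, <- (comp_assoc (fmap R _)), !transpose_eta.
now rewrite !comp_assoc, transpose_eta.
Qed.

Definition left_adjoint : functor A B :=
  {| fob := l;
     fmap := fun x y f => transpose (eta y ∘ f);
     fmap_id := left_adjoint_id;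
     fmap_comp := left_adjoint_comp |}.

Lemma left_adjoint_unit_natural (x y : A) (f : hom x y) :
  eta y ∘ fmap (functor_id A) f = fmap (functor_comp R left_adjoint) f ∘ eta x.
Proof. simpl. now rewrite transpose_eta. Qed.

(** Both sides are the transpose of [fmap R f]. *)
Lemma left_adjoint_counit_natural (x y : B) (f : hom x y) :
  transpose (idm (R y)) ∘ fmap (functor_comp left_adjoint R) f
  = fmap (functor_id B) f ∘ transpose (idm (R x)).
Proof.
simpl. apply (universal_arrow_ext (eta_universal (x := R x))).
rewrite !fmap_comp, <- !comp_assoc, !transpose_eta.
now rewrite comp_assoc, transpose_eta, comp_idl, comp_idr.
Qed.

Definition left_adjoint_unit : nat_trans (functor_id A) (functor_comp R left_adjoint) :=
  @NatTrans _ _ (functor_id A) (functor_comp R left_adjoint) eta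
    left_adjoint_unit_natural.

Definition left_adjoint_counit : nat_trans (functor_comp left_adjoint R) (functor_id B) :=
  @NatTrans _ _ (functor_comp left_adjoint R) (functor_id B)
    (fun y => transpose (idm (R y))) left_adjoint_counit_natural.

Lemma left_adjoint_triangle_l (x : A) :
  left_adjoint_counit (left_adjoint x) ∘ fmap left_adjoint (left_adjoint_unit x)
  = idm (left_adjoint x).
Proof.
simpl. apply (universal_arrow_ext (eta_universal (x := x))).
rewrite fmap_comp, <- comp_assoc, transpose_eta.
now rewrite comp_assoc, transpose_eta, fmap_id.
Qed.

Definition left_adjoint_adjunction : adjunction left_adjoint R :=
  {| adj_unit := left_adjoint_unit;
     adj_counit := left_adjoint_counit;
     adj_triangle_l := left_adjoint_triangle_l;
     adj_triangle_r := fun y => transpose_eta (idm (R y)) |}.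
End LeftAdjoint.

(** * Existence of universal arrows, and its passage to retracts *)

Definition has_universal_arrow (A B : category) (R : functor B A) (x : A) : Prop :=
  exists u : {l : B & hom x (R l)}, universal_arrow (projT2 u).

Lemma has_left_adjoint_of_universal_arrows (A B : category) (R : functor B A) :
  (forall x, has_universal_arrow R x) -> has_left_adjoint R.
Proof.
intros H.
(* Object and arrow form one sigma type, so a single choice picks both together. *)
pose (u x := constructive_indefinite_description _ (H x)).
exists (left_adjoint (fun x => proj2_sig (u x))).
constructor. apply left_adjoint_adjunction.
Qed.

(** The idempotent [i ∘ q] on [z] transposes to an idempotent [p] on [l]; an object splitting [p]
    represents the maps out of [x]. *)
Lemma has_universal_arrow_retract (A B : category) (R : functor B A) (x z : A)
    (i : hom x z) (q : hom z x) :
  cauchy_complete B -> q ∘ i = idm x ->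
  has_universal_arrow R z -> has_universal_arrow R x.
Proof.
intros CB qi [[l eta] U]; simpl in U.
destruct (U l (eta ∘ (i ∘ q))) as [p [Hp _]].
assert (pp : p ∘ p = p).
{ apply (universal_arrow_ext U).
  rewrite fmap_comp, <- comp_assoc, Hp, comp_assoc, Hp.
  rewrite <- !comp_assoc, (comp_assoc q i q), qi.
  now rewrite comp_idl. }
destruct (CB l p pp) as [b [r [s [sr rs]]]].
exists (existT _ b (fmap R r ∘ eta ∘ i)); simpl. intros y f.
destruct (U y (f ∘ q)) as [g [Hg Ug]].
(* [g] is the transpose of [f ∘ q], restricted here to the retract [b] of [l]. *)
exists (g ∘ s); split.
- rewrite !comp_assoc, <- fmap_comp, <- (comp_assoc g s r), sr, fmap_comp.
  rewrite <- (comp_assoc _ _ eta), Hp, comp_assoc, Hg, <- !comp_assoc.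
  now rewrite qi, comp_idr, qi, comp_idr.
- intros g' Hg'.
  (* Since [g'] equals [g' ∘ r ∘ s], it suffices that [g' ∘ r] is also a transpose of [f ∘ q]; this
     follows from [r ∘ p = r]. *)
  rewrite <- (comp_idr g'), <- rs, comp_assoc. f_equal.
  apply Ug.
  assert (rp : r ∘ p = r) by now rewrite <- sr, comp_assoc, rs, comp_idl.
  rewrite <- rp, !fmap_comp, <- !comp_assoc, Hp, <- Hg'.
  now rewrite <- !comp_assoc.
Qed.

(** * Splitting idempotents in the Eilenberg-Moore category *)

Section RetractAlgebra.
Variables (A : category) (T : monad A) (x : algebra T) (e : algebra_hom x x).
Variables (b : A) (r : hom (carrier x) b) (s : hom b (carrier x)).
Hypotheses (sr : s ∘ r = under e) (rs : r ∘ s = idm b).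

(** [s ∘ r] underlies the algebra map [e], so it slides past the action, where [r] absorbs it. This
    gives both associativity of the new action and the fact that [r] is a homomorphism. *)
Lemma retract_action_r :
  r ∘ action x ∘ fmap T s ∘ fmap T r = r ∘ action x.
Proof.
rewrite <- comp_assoc, <- fmap_comp, sr, <- comp_assoc, <- under_action.
now rewrite <- sr, !comp_assoc, rs, comp_idl.
Qed.

Lemma retract_action_unit :
  r ∘ action x ∘ fmap T s ∘ unit T b = idm b.
Proof.
rewrite <- comp_assoc, <- (naturality (unit T) s); simpl.
rewrite comp_assoc, <- (comp_assoc r).
rewrite_simpl (action_unit x). now rewrite comp_idr.
Qed.

Lemma retract_action_mult :
  r ∘ action x ∘ fmap T s ∘ mult T b
  = r ∘ action x ∘ fmap T s ∘ fmap T (r ∘ action x ∘ fmap T s).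
Proof.
rewrite !fmap_comp, !comp_assoc, retract_action_r.
rewrite <- (comp_assoc r _ (fmap T (action x))), <- action_mult.
rewrite <- !comp_assoc. do 2 f_equal.
symmetry; apply (naturality (mult T) s).
Qed.

(** As [r ∘ s] is the identity, this is the only action on [b] for which [s] can be a
    homomorphism. *)
Definition retract_algebra : algebra T :=
  {| carrier := b;
     action := r ∘ action x ∘ fmap T s;
     action_unit := retract_action_unit;
     action_mult := retract_action_mult |}.

Lemma retract_r_action : r ∘ action x = action retract_algebra ∘ fmap T r.
Proof. symmetry; apply retract_action_r. Qed.

Lemma retract_s_action : s ∘ action retract_algebra = action x ∘ fmap T s.
Proof.
simpl. rewrite !comp_assoc, sr, under_action, <- comp_assoc, <- fmap_comp.
now rewrite <- sr, <- comp_assoc, rs, comp_idr.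
Qed.
End RetractAlgebra.

Lemma eilenberg_moore_cauchy_complete (A : category) (T : monad A) :
  cauchy_complete A -> cauchy_complete (eilenberg_moore T).
Proof.
intros CA x e ee.
destruct (CA _ (under e) (f_equal (@under _ _ _ _) ee)) as [b [r [s [sr rs]]]].
exists (retract_algebra sr rs).
exists (@AlgebraHom _ _ x (retract_algebra sr rs) r (retract_r_action sr rs)).
exists (@AlgebraHom _ _ (retract_algebra sr rs) x s (retract_s_action sr rs)).
now split; apply algebra_hom_eq.
Qed.

(** * Free algebras and their universal arrows *)

Definition free_algebra (A : category) (T : monad A) (a : A) : algebra T :=
  {| carrier := T a;
     action := mult T a;
     action_unit := mult_unitl T a;
     action_mult := eq_sym (mult_assoc T a) |}.

(** Slide [g] past the multiplication and apply the right unit law; hence a map out of a free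
    algebra is determined by its restriction along the unit. *)
Lemma free_algebra_hom_eq (A : category) (T : monad A) (a : A) (x : algebra T)
    (g : algebra_hom (free_algebra T a) x) :
  under g = action x ∘ fmap T (under g ∘ unit T a).
Proof.
rewrite fmap_comp, comp_assoc, <- under_action; simpl.
rewrite <- comp_assoc. rewrite_simpl (mult_unitr T a). now rewrite comp_idr.
Qed.

Lemma free_algebra_ext_action (A : category) (T : monad A) (a : A)
    (x : algebra T) (f : hom a (carrier x)) :
  (action x ∘ fmap T f) ∘ action (free_algebra T a)
  = action x ∘ fmap T (action x ∘ fmap T f).
Proof.
rewrite fmap_comp, comp_assoc, <- action_mult, <- !comp_assoc.
f_equal. symmetry; apply (naturality (mult T) f).
Qed.

Definition free_algebra_ext (A : category) (T : monad A) (a : A)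
    (x : algebra T) (f : hom a (carrier x)) : algebra_hom (free_algebra T a) x :=
  {| under := action x ∘ fmap T f : hom (carrier (free_algebra T a)) (carrier x);
     under_action := free_algebra_ext_action f |}.

Lemma free_algebra_ext_unit (A : category) (T : monad A) (a : A)
    (x : algebra T) (f : hom a (carrier x)) :
  under (free_algebra_ext f) ∘ unit T a = f.
Proof.
simpl. rewrite <- comp_assoc.
rewrite_simpl (eq_sym (naturality (unit T) f)). rewrite comp_assoc.
rewrite_simpl (action_unit x). now rewrite comp_idl.
Qed.

Lemma iota_action (A : category) (S T : monad A) (iota : monad_morphism S T)
    (a : A) :
  iota a ∘ action (free_algebra S a)
  = action (restrict_algebra iota (free_algebra T a)) ∘ fmap S (iota a).
Proof. simpl. rewrite_simpl (mm_mult iota a). apply comp_assoc. Qed.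

(** Maps from the free [S]-algebra on [a] to a restricted [y], and maps from the free [T]-algebra on
    [a] to [y], both correspond to maps from [a] to [carrier y]; [iota a] mediates because it
    preserves units. *)
Lemma has_universal_arrow_free (A : category) (S T : monad A)
    (iota : monad_morphism S T) (a : A) :
  has_universal_arrow (restriction_of_base iota) (free_algebra S a).
Proof.
exists (existT (fun l => hom (_ : eilenberg_moore S) (restriction_of_base iota l))
  (free_algebra T a : eilenberg_moore T)
  (@AlgebraHom _ _ (free_algebra S a)
     (restrict_algebra iota (free_algebra T a)) (iota a) (iota_action iota a))).
simpl. intros y f. simpl in y, f.
exists (free_algebra_ext (x := y) (under f ∘ unit S a)). split.
- apply algebra_hom_eq; simpl.
  rewrite <- comp_assoc, <- (naturality iota), comp_assoc.
  symmetry. apply (free_algebra_hom_eq f).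
- intros g Hg. apply algebra_hom_eq. simpl in g.
  rewrite (free_algebra_hom_eq g); simpl. do 2 f_equal.
  rewrite <- Hg; simpl. rewrite <- comp_assoc. now rewrite_simpl (mm_unit iota a).
Qed.

(** * The section of the action given by the Frobenius structure *)

Section AlgebraSection.
Variables (A : category) (S : monad A) (D : comonad_structure S).
Hypothesis D_frobenius : frobenius_law D.
Variable x : algebra S.

Definition algebra_section : hom (carrier x) (S (carrier x)) :=
  fmap S (action x) ∘ comult D (carrier x) ∘ unit S (carrier x).

(* Both sides equal [S h . delta]. *)
Lemma algebra_section_action :
  algebra_section ∘ action x
  = action (free_algebra S (carrier x)) ∘ fmap S algebra_section.
Proof.
unfold algebra_section; simpl. transitivity (fmap S (action x) ∘ comult D (carrier x)).
(* Naturality of the unit and of [comult D] moves [action x] to the left, where the algebra law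
   turns it into a multiplication; the first Frobenius equation and the left unit law finish. *)
- rewrite <- comp_assoc. rewrite_simpl (naturality (unit S) (action x)).
  rewrite comp_assoc.
  rewrite <- (comp_assoc (fmap S (action x))).
  rewrite_simpl (naturality (comult D) (action x)).
  rewrite comp_assoc, <- fmap_comp, <- action_mult, fmap_comp.
  rewrite <- (comp_assoc (fmap S (action x))).
  rewrite_simpl (proj1 (D_frobenius (carrier x))).
  rewrite <- !comp_assoc. rewrite_simpl (mult_unitl S (carrier x)).
  now rewrite comp_idr.
(* Here naturality of the multiplication, the second Frobenius equation and the right unit law are
   used. *)
- rewrite !fmap_comp, !comp_assoc.
  rewrite_simpl (naturality (mult S) (action x)).
  rewrite <- (comp_assoc (fmap S (action x))).
  rewrite_simpl (eq_sym (proj2 (D_frobenius (carrier x)))).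
  rewrite <- !comp_assoc. rewrite_simpl (mult_unitr S (carrier x)).
  now rewrite comp_idr.
Qed.

Hypothesis D_separable : forall a, mult S a ∘ comult D a = idm (S a).

(** The algebra law turns the two actions into a multiplication, which separability cancels against
    [comult D]; what remains is the unit law of [x]. *)
Lemma action_algebra_section : action x ∘ algebra_section = idm (carrier x).
Proof.
unfold algebra_section.
rewrite !comp_assoc, <- action_mult, <- (comp_assoc (action x)).
rewrite D_separable, comp_idr. apply action_unit.
Qed.
End AlgebraSection.

Theorem proposition3p2 (A : category) (S : monad A)
    (A_cauchy_complete : cauchy_complete A)
    (S_frobenius_separable : frobenius_separable S) :
  forall (T : monad A) (iota : monad_morphism S T),
    change_of_base_exists iota.
Proof.
intros T iota. destruct S_frobenius_separable as [D [DF DS]].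
apply has_left_adjoint_of_universal_arrows. intros x.
(* By [action_mult], the action is itself a homomorphism from the free algebra, and it serves as the
   retraction. *)
apply (@has_universal_arrow_retract _ _ _ x (free_algebra S (carrier x))
  (@AlgebraHom _ _ x (free_algebra S (carrier x)) (algebra_section D x)
     (algebra_section_action DF x))
  (@AlgebraHom _ _ (free_algebra S (carrier x)) x (action x) (action_mult x))).
- now apply eilenberg_moore_cauchy_complete.
- apply algebra_hom_eq, action_algebra_section, DS.
- apply has_universal_arrow_free.
Qed.
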